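(* Let $f:\mathbb{R}_{\geq 0}\to\mathbb{R}_{\geq 0}$ be a decent function. Then there exists a monotone graph class $\mathcal{X}$ with speed $|\mathcal{X}_n|=2^{O(nf(n))}$ that does not admit a universal graph of size at most $2^{f(n)\log n}$. Equivalently, $\mathcal{X}$ admits no adjacency labeling scheme of size at most $f(n)\log n$.
   Context: All graphs are finite, undirected, without loops or multiple edges; $\log$ is the base-2 logarithm; asymptotic notation is as $n\to\infty$. A class of graphs is a set of graphs closed under isomorphism. A class is monotone if it is closed under taking subgraphs (i.e., under vertex and edge deletions). For a class $\mathcal{X}$, $\mathcal{X}_n$ denotes the set of graphs in $\mathcal{X}$ with vertex set $[n]=\{1,\dots,n\}$, and $n\mapsto|\mathcal{X}_n|$ is the speed of $\mathcal{X}$. A non-decreasing function $f:\mathbb{R}_{\geq 0}\to\mathbb{R}_{\geq 0}$ is $(\delta,C,s)$-decent, for constants $\delta\in(0,1)$, $C\geq 1$, $s\geq 2$, if (moderate-growth) $\log x\leq f(x)\leq C\cdot x^{1-\delta}$ for every $x\in[s,\infty)$, and (sub-multiplicativity) $f(xy)\leq C\cdot f(x)\cdot f(y)$ for all $x,y\in[s,\infty)$. It is decent if it is $(\delta,C,s)$-decent for some such constants. A universal graph of size $u(n)$ for $\mathcal{X}$ is a sequence $(U_n)_{n\in\mathbb{N}}$ of graphs such that for every $n\in\mathbb{N}$ the graph $U_n$ has at most $u(n)$ vertices and every $n$-vertex graph in $\mathcal{X}$ is (isomorphic to) an induced subgraph of $U_n$. A $b(n)$-bit adjacency labeling scheme for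 $\mathcal{X}$ (an adjacency labeling scheme of size $b(n)$) is a pair (encoder, decoder) such that for any $n$-vertex graph $G\in\mathcal{X}_n$ the encoder assigns binary strings (labels) of length $b(n)$ to the vertices of $G$ so that the adjacency between any pair of vertices can be inferred by the decoder from their two labels only; the decoder depends on $\mathcal{X}$ but not on $G$. The existence of a $b(n)$-bit labeling scheme is equivalent to the existence of a universal graph of size $2^{b(n)}$. *)

(* Defs.v *)
From mathcomp Require Import all_boot all_order all_algebra.
From mathcomp Require Import all_classical all_reals all_analysis.
Import Order.TTheory GRing.Theory Num.Theory.
Import numFieldNormedType.Exports.

Set Implicit Arguments.
Unset Strict Implicit.
Unset Printing Implicit Defensive.

Local Open Scope classical_set_scope.
Local Open Scope ring_scope.

(* Finite simple graphs, given by their set of edges, an edge being a set of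
   exactly two vertices. *)
Definition sgraph (T : finType) : Type :=
  {E : {set {set T}} | [forall e in E, #|e| == 2%N]}.

(* No loops: [set x; x] has one element, hence is never an edge. *)
Definition adj (T : finType) (G : sgraph T) (x y : T) : bool :=
  [set x; y]%SET \in val G.

Definition isomorphic (T T' : finType) (G : sgraph T) (H : sgraph T') : Prop :=
  exists2 h : T -> T', bijective h & forall x y, adj H (h x) (h y) = adj G x y.

(* In the next two definitions the inclusion is up to isomorphism; for classes
   closed under isomorphism this makes no difference. *)
Definition subgraph (T T' : finType) (G : sgraph T) (H : sgraph T') : Prop :=
  exists2 h : T -> T', injective h & forall x y, adj G x y -> adj H (h x) (h y).

Definition induced_subgraph (T T' : finType) (G : sgraph T) (H : sgraph T') :
    Prop :=
  exists2 h : T -> T', injective h & forall x y, adj H (h x) (h y) = adj G x y.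

Record graph_class := GraphClass {
  in_class :> forall T : finType, sgraph T -> Prop;
  in_class_iso : forall (T T' : finType) (G : sgraph T) (H : sgraph T'),
    isomorphic G H -> in_class G -> in_class H
}.

Definition monotone_class (X : graph_class) : Prop :=
  forall (T T' : finType) (G : sgraph T) (H : sgraph T'),
    subgraph H G -> X T G -> X T' H.

(* Labelled graphs on n vertices: 'I_n = {0, ..., n-1} stands for [n]. *)
Definition class_at (X : graph_class) (n : nat) : {set sgraph 'I_n} :=
  [set G : sgraph 'I_n | `[< X _ G >]]%SET.

Definition speed (X : graph_class) (n : nat) : nat := #|class_at X n|.

Section RealSizes.
Variable R : realType.

Definition log2 (x : R) : R := ln x / ln 2.

(* |X_n| = 2^(O(h n)) *)
Definition speed_exp_bigO (X : graph_class) (h : nat -> R) : Prop :=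
  exists2 g : nat -> R,
    (forall n, (speed X n)%:R = 2 `^ g n) & (g =O_\oo h).

(* f is total on R, but only its values on [0, +oo[ are constrained. *)
Definition decent_with (delta C s : R) (f : R -> R) : Prop :=
  [/\ forall x : R, 0 <= x -> 0 <= f x,
      forall x y : R, 0 <= x -> x <= y -> f x <= f y,
      forall x : R, s <= x -> log2 x <= f x /\ f x <= C * x `^ (1 - delta) &
      forall x y : R, s <= x -> s <= y -> f (x * y) <= C * f x * f y].

Definition decent (f : R -> R) : Prop :=
  exists delta C s : R,
    [/\ 0 < delta < 1, 1 <= C, 2 <= s & decent_with delta C s f].

Definition universal_graph (X : graph_class) (u : nat -> R)
    (V : nat -> finType) (U : forall n, sgraph (V n)) : Prop :=
  forall n, #|V n|%:R <= u n /\
    forall (T : finType) (G : sgraph T),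
      #|T| = n -> X T G -> induced_subgraph G (U n).

(* Labels of distinct vertices may coincide, and only pairs of distinct
   vertices are decoded. *)
Definition labeling_scheme (X : graph_class) (b : nat -> nat)
    (encoder : forall n, sgraph 'I_n -> 'I_n -> (b n).-tuple bool)
    (decoder : seq bool -> seq bool -> bool) : Prop :=
  forall n (G : sgraph 'I_n), G \in class_at X n ->
    forall x y : 'I_n, x != y ->
      decoder (encoder n G x) (encoder n G y) = adj G x y.

(* "Size at most v(n)" is asymptotic: the size is bounded by v(n) for all
   sufficiently large n.  Were the bound imposed at every n, failing it at one
   single n would suffice for non-existence, and the class of all graphs with
   at most N vertices together with all edgeless graphs, for a suitable N,
   would already do. *)
Definition admits_universal_graph_of_size_at_most
    (X : graph_class) (v : nat -> R) : Prop :=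
  exists (u : nat -> R) (V : nat -> finType) (U : forall n, sgraph (V n)),
    (\forall n \near \oo, u n <= v n) /\ universal_graph X u U.

Definition admits_labeling_scheme_of_size_at_most
    (X : graph_class) (v : nat -> R) : Prop :=
  exists (b : nat -> nat)
    (encoder : forall n, sgraph 'I_n -> 'I_n -> (b n).-tuple bool)
    (decoder : seq bool -> seq bool -> bool),
    (\forall n \near \oo, (b n)%:R <= v n) /\
    labeling_scheme X encoder decoder.

End RealSizes.

(* Main.v *)
Require Import Defs.
From mathcomp Require Import all_boot all_order all_algebra.
From mathcomp Require Import all_classical all_reals all_analysis.
From mathcomp Require Import ring lra zify.
Import Order.TTheory GRing.Theory Num.Theory.
Import numFieldNormedType.Exports.
Local Open Scope ring_scope.

Set Implicit Arguments.
Unset Strict Implicit.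
Unset Printing Implicit Defensive.

(** The class consists of all subgraphs of the members of finite families F_n
    of graphs on n vertices, one family for each large n.  The families come
    from a first-moment count over random graphs, and they have to meet two
    opposite demands.

    They must be too rich for a small universal graph.  A universal graph and a
    labelling scheme both amount to a binary relation D on a set of u = n^f(n)
    points together with a map into this set for every graph of the class
    (lemma small_relation_misses).  A random graph with M = (4/delta) n f(n)
    edges is described by D in this way with probability at most
    u^n (O(M)/n^2)^M: there are u^n maps, and each of them determines the graph.
    Since f(n)/n <= C n^(-delta), this is below 1/4 for large n (lemma
    few_encodings).  There are only 2^(u^2) relations, so that u^2 graphs drawn
    independently defeat all of them at once with positive probability (lemma
    avoiding_family).  This is where the factor log n is gained:
    u^2 = 2^(2 f(n) log n) graphs are many enough to defeat every D, and few
    enough to be negligible against 2^(n f(n)).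

    They must also have few subgraphs on k vertices, for each k <= n.  With
    probability at least 3/4, for every k from some constant up to n, any k
    vertices of the random graph span
    - O(k f(k)) edges if n <= k^2 (lemma dense_regime),
    - O(k f(k) / log k) edges if n > k^2 (lemma sparse_regime).
    Both bounds rest on f(n) <= C f(k) f(n/k), which compares the mean number of
    edges k^2 f(n)/n spanned by k vertices with k f(k); in the second range the
    comparison gains a factor n^(-delta/4), which pays for the missing log k.

    The speed follows by treating a k-vertex graph of the class according to the
    size n of its host (lemma speed_family_class).  If n > k^2, it has
    O(k f(k) / log k) edges, and there are only 2^(O(k f(k))) such graphs
    whatever their hosts are.  If n <= k^2, it is given by n, a member of F_n, an
    injection of the k vertices and a subset of the O(k f(k)) edges found there;
    each of these has 2^(O(k f(k))) choices, because
    f(n) log n <= f(k^2) log (k^2) <= 2 C f(k)^2 log k = O(k f(k)).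

    Asymptotics are handled with natural logarithms, as 2^(f(n) log2 n) is
    exp(f(n) ln n). *)

(** * Counting functions with many values in a given set *)

Lemma leq_card_bigcup (I T : finType) (P : pred I) (A : I -> {set T}) :
  (#|\bigcup_(i | P i) A i| <= \sum_(i | P i) #|A i|)%N.
Proof.
elim/big_rec2: _ => [|i m B _ leBm]; first by rewrite cards0.
by rewrite (leq_trans (leq_card_setU _ _)) // leq_add2l.
Qed.

(** A form of t! >= (t/4)^t; it follows from t^t <= (2t)!/t! and from
    C(2t, t) <= 4^t. *)
Lemma leq_exp_fact t : (t ^ t <= 4 ^ t * t`!)%N.
Proof.
have ffact_ge : (t ^ t <= (t + t) ^_ t)%N.
  rewrite -[X in (t ^ X)%N]card_ord -prod_nat_const ffact_prod.
  by apply: leq_prod => i _; rewrite -addnBA ?leq_addr // ltnW.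
apply: leq_trans ffact_ge _; rewrite -bin_ffact leq_mul2r; apply/orP; right.
have -> : (4 ^ t = 2 ^ (t + t))%N by rewrite addnn -mul2n expnM.
rewrite -[X in 'C(X, _)]card_ord -card_draws -[X in (_ <= 2 ^ X)%N]card_ord.
rewrite -cardsT -card_powerset subset_leq_card //.
by apply/fintype.subsetP => B _; rewrite powersetE finset.subsetT.
Qed.

Lemma card_ffun_on_subset (I T : finType) (J : {set I}) (A : {set T}) :
  (#|[set g : {ffun I -> T} | [forall i in J, g i \in A]]| * #|T| ^ #|J|
     = #|A| ^ #|J| * #|T| ^ #|I|)%N.
Proof.
have -> : [set g : {ffun I -> T} | [forall i in J, g i \in A]] =
    [set g in family (fun i => [pred x | (i \in J) ==> (x \in A)])].
  apply/finset.setP => g; rewrite !inE.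
  by apply/forallP/forallP => H i; have := H i.
rewrite cardsE card_family foldrE big_image /=.
rewrite (eq_bigr (fun i => if i \in J then #|A| else #|T|)); last first.
  by move=> i _; case: (i \in J) => /=; apply: eq_card => x.
rewrite big_if /= !prod_nat_const -mulnA; congr (_ * _)%N.
by rewrite -expnD addnC -(cardC (mem J)).
Qed.

(** Union bound over the set J of t indices that are sent into A. *)
Lemma card_many_hits (M : nat) (T : finType) (A : {set T}) (t : nat) :
  (#|[set g : {ffun 'I_M -> T} | t <= #|[set i | g i \in A]|]| * #|T| ^ t
     <= 'C(M, t) * (#|A| ^ t * #|T| ^ M))%N.
Proof.
pose J_ok := [pred J : {set 'I_M} | #|J| == t].
pose B (J : {set 'I_M}) := [set g : {ffun 'I_M -> T} | [forall i in J, g i \in A]].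
have sub : [set g : {ffun 'I_M -> T} | t <= #|[set i | g i \in A]|]%N
    \subset \bigcup_(J | J_ok J) B J.
  apply/fintype.subsetP => g; rewrite inE => /(card_geqP) [s [us ss sA]].
  apply/finset.bigcupP; exists [set x in s].
    by rewrite /= cardsE (card_uniqP us) ss.
  rewrite inE; apply/forall_inP => i; rewrite inE => is_; have := sA i is_.
  by rewrite inE.
have leB := leq_trans (subset_leq_card sub) (leq_card_bigcup J_ok B).
apply: leq_trans (leq_mul leB (leqnn _)) _.
rewrite big_distrl /= (eq_bigr (fun=> #|A| ^ t * #|T| ^ M)%N); last first.
  move=> J /eqP cJ; have := card_ffun_on_subset J A.
  by rewrite cJ card_ord.
rewrite sum_nat_const -[X in 'C(X, t)]card_ord -card_draws cardsE.
exact: leqnn.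
Qed.

(** The probability that at least t of M independent uniform elements of T fall
    into A is at most (4 M |A| / (t |T|))^t: the estimate C(M, t) <= M^t / t! is
    combined with t! >= (t/4)^t. *)
Lemma card_many_hits_le (M : nat) (T : finType) (A : {set T}) (t : nat) :
  (#|[set g : {ffun 'I_M -> T} | t <= #|[set i | g i \in A]|]| * (t * #|T|) ^ t
     <= (4 * M * #|A|) ^ t * #|T| ^ M)%N.
Proof.
rewrite [in X in (X <= _)%N]expnMn [X in (_ * X <= _)%N]mulnC mulnA.
apply: leq_trans (leq_mul (card_many_hits M A t) (leq_exp_fact t)) _.
have -> : ('C(M, t) * (#|A| ^ t * #|T| ^ M) * (4 ^ t * t`!)
  = ('C(M, t) * t`!) * (4 ^ t * #|A| ^ t * #|T| ^ M))%N.
  by ring.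
rewrite bin_ffact !expnMn mulnA [(_ * (4 ^ t * _))%N]mulnA [(_ * 4 ^ t)%N]mulnC.
rewrite !leq_mul2r; apply/orP; right; apply/orP; right.
rewrite leq_mul2l; apply/orP; right.
rewrite ffact_prod -[X in (M ^ X)%N](card_ord t) -prod_nat_const.
by apply: leq_prod => i _; rewrite leq_subr.
Qed.

(** * Random graphs and the relations that describe them *)

Lemma leq_expl (m n e : nat) : (m <= n -> m ^ e <= n ^ e)%N.
Proof. by case: e => // e; rewrite leq_exp2r. Qed.

Lemma set2_inj (T : finType) (a b x y : T) :
  a != b -> [set a; b]%SET = [set x; y]%SET -> (a, b) = (x, y) \/ (a, b) = (y, x).
Proof.
move=> ab eqS; have := set21 a b; have := set22 a b.
rewrite eqS !in_set2 => /orP[]/eqP eb /orP[]/eqP ea; subst; auto;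
  by move: ab; rewrite eqxx.
Qed.

(** The random graph is drawn as a sequence of M independent pairs of vertices:
    loops are discarded and repetitions merge.  Compared with independent edges,
    this model turns probabilities into cardinals of sets of functions. *)
Definition pair_edges (n M : nat) (e : {ffun 'I_M -> 'I_n * 'I_n}) :
    {set {set 'I_n}} :=
  [set [set (e i).1; (e i).2]%SET | i : 'I_M & (e i).1 != (e i).2]%SET.

Lemma pair_edgesP (n M : nat) (e : {ffun 'I_M -> 'I_n * 'I_n}) :
  [forall E in pair_edges e, #|E| == 2%N].
Proof.
by apply/forall_inP => E /imsetP[i]; rewrite inE => neq ->; rewrite cards2 neq.
Qed.

Definition graph_of_pairs (n M : nat) (e : {ffun 'I_M -> 'I_n * 'I_n}) :
    sgraph 'I_n :=
  exist _ (pair_edges e) (pair_edgesP e).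

Lemma adj_neq (T : finType) (G : sgraph T) (x y : T) : adj G x y -> x != y.
Proof.
case: G => E cardE; rewrite /adj /= => xyE.
have /forall_inP/(_ _ xyE) := cardE; rewrite cards2.
by case: (x == y).
Qed.

Lemma adj_graph_of_pairs (n M : nat) (e : {ffun 'I_M -> 'I_n * 'I_n}) x y :
  adj (graph_of_pairs e) x y -> exists i, e i = (x, y) \/ e i = (y, x).
Proof.
move=> /imsetP[i]; rewrite inE => neq /esym /(set2_inj neq) eq_xy.
by exists i; rewrite [e i]surjective_pairing.
Qed.

Lemma graph_of_pairs_adj (n M : nat) (e : {ffun 'I_M -> 'I_n * 'I_n}) i :
  (e i).1 != (e i).2 -> adj (graph_of_pairs e) (e i).1 (e i).2.
Proof. by move=> neq; apply/imsetP; exists i; rewrite ?inE. Qed.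

(** Universal graphs and labelling schemes are treated alike: D is a graph or a
    decoder, h an embedding or an encoder.  As a decoder may be asymmetric and
    labels may coincide, D is an arbitrary relation and h an arbitrary map. *)
Definition encodes (u n : nat) (D : {ffun 'I_u * 'I_u -> bool})
    (h : {ffun 'I_n -> 'I_u}) (G : sgraph 'I_n) : bool :=
  [forall x, forall y, (x != y) ==> (D (h x, h y) == adj G x y)].

Lemma encodesP (u n : nat) (D : {ffun 'I_u * 'I_u -> bool})
    (h : {ffun 'I_n -> 'I_u}) (G : sgraph 'I_n) :
  reflect (forall x y, x != y -> D (h x, h y) = adj G x y) (encodes D h G).
Proof.
apply: (iffP forallP) => [enc x y neq|enc x].
  by have /forallP/(_ y) := enc x; rewrite neq => /eqP.
by apply/forallP => y; apply/implyP => /enc ->.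
Qed.

(** All sequences described by one map h have the same graph, namely that of any
    of them, e0.  Hence each of their pairs is a loop, for which there are n
    possibilities, or one of the at most M edges of e0 in one of two
    orientations. *)
Lemma card_encoded_by (u n M : nat) (D : {ffun 'I_u * 'I_u -> bool})
    (h : {ffun 'I_n -> 'I_u}) :
  (#|[set e : {ffun 'I_M -> 'I_n * 'I_n} | encodes D h (graph_of_pairs e)]%SET|
    <= (2 * M + n) ^ M)%N.
Proof.
set S := [set e | _]%SET.
have [->|[e0 e0S]] := finset.set_0Vmem S; first by rewrite cards0.
pose P := [set xy : 'I_n * 'I_n | (xy.1 == xy.2) ||
  adj (graph_of_pairs e0) xy.1 xy.2]%SET.
have cardP : (#|P| <= 2 * M + n)%N.
  pose diag := [set (x, x) | x : 'I_n]%SET.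
  pose fwd := [set e0 i | i : 'I_M]%SET.
  pose bwd := [set ((e0 i).2, (e0 i).1) | i : 'I_M]%SET.
  have sub : P \subset fwd :|: bwd :|: diag.
    apply/fintype.subsetP => -[x y]; rewrite /P !inE /= => /orP[/eqP ->|].
      by rewrite [X in _ || X]imset_f ?orbT.
    move=> /adj_graph_of_pairs [i [] ei]; apply/orP; left; apply/orP.
      by left; rewrite -ei imset_f.
    right; have -> : (x, y) = ((e0 i).2, (e0 i).1) by rewrite ei.
    exact: imset_f.
  apply: leq_trans (subset_leq_card sub) _.
  apply: leq_trans (leq_card_setU _ _) _; apply: leq_add.
    apply: leq_trans (leq_card_setU _ _) _; rewrite mul2n -addnn.
    by apply: leq_add; apply: leq_trans (leq_imset_card _ _) _; rewrite card_ord.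
  by apply: leq_trans (leq_imset_card _ _) _; rewrite card_ord.
have sub : S \subset [set e in ffun_on (mem P)]%SET.
  apply/fintype.subsetP => e; rewrite /S inE => /encodesP enc.
  rewrite inE; apply/ffun_onP => i; rewrite /P inE.
  case: eqVneq => //= neq.
  have /encodesP enc0 : encodes D h (graph_of_pairs e0).
    by move: e0S; rewrite /S inE.
  by rewrite -(enc0 _ _ neq) (enc _ _ neq); apply: graph_of_pairs_adj.
apply: leq_trans (subset_leq_card sub) _.
rewrite cardsE card_ffun_on card_ord.
exact: leq_expl.
Qed.

Lemma card_encodable (u n M : nat) (D : {ffun 'I_u * 'I_u -> bool}) :
  (#|[set e : {ffun 'I_M -> 'I_n * 'I_n} |
      [exists h, encodes D h (graph_of_pairs e)]]%SET|
    <= u ^ n * (2 * M + n) ^ M)%N.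
Proof.
have -> : [set e : {ffun 'I_M -> 'I_n * 'I_n} |
      [exists h, encodes D h (graph_of_pairs e)]]%SET =
  \bigcup_h [set e | encodes D h (graph_of_pairs e)]%SET.
  apply/finset.setP => e; rewrite inE.
  apply/existsP/finset.bigcupP => [[h ench]|[h _]]; first by exists h; rewrite ?inE.
  by rewrite inE; exists h.
apply: leq_trans (leq_card_bigcup _ _) _.
apply: leq_trans (leq_sum _ (fun h _ => card_encoded_by M D h)) _.
by rewrite sum_nat_const card_ffun !card_ord.
Qed.

(** Counting families of K members of good: if each bad d has at most B elements,
    the families lying inside some bad d number at most
    2^K B^K = (2 B)^K < |good|^K. *)
Lemma avoiding_family (E I : finType) (good : {set E}) (bad : I -> {set E})
    (K B : nat) :
  (0 < K)%N -> (#|I| <= 2 ^ K)%N -> (forall d, #|bad d| <= B)%N ->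
  (2 * B < #|good|)%N ->
  exists2 F : {ffun 'I_K -> E}, forall i, F i \in good &
    forall d, exists i, F i \notin bad d.
Proof.
move=> K_gt0 cardI card_bad card_good.
pose all_bad := (\bigcup_d [set F : {ffun 'I_K -> E} in ffun_on (mem (bad d))])%SET.
pose all_good := [set F : {ffun 'I_K -> E} in ffun_on (mem good)]%SET.
have lt_bad : (#|all_bad| < #|all_good|)%N.
  apply: leq_ltn_trans (leq_card_bigcup _ _) _.
  apply: (@leq_ltn_trans (\sum_(d : I) B ^ K)%N).
    apply: leq_sum => d _; rewrite cardsE card_ffun_on card_ord.
    exact: leq_expl (card_bad d).
  rewrite sum_nat_const cardsE card_ffun_on card_ord.
  apply: (@leq_ltn_trans ((2 * B) ^ K)%N); last by rewrite ltn_exp2r.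
  by rewrite expnMn leq_mul2r cardI orbT.
have [F Fgood Fbad] : exists2 F, F \in all_good & F \notin all_bad.
  apply/exists_inP; apply: contraLR lt_bad => /exists_inPn H.
  rewrite -leqNgt; apply: subset_leq_card; apply/fintype.subsetP => F /H.
  by rewrite negbK.
exists F; first by apply/ffun_onP; move: Fgood; rewrite inE.
move=> d; apply/existsP; apply: contraR Fbad; rewrite negb_exists => /forallP H.
apply/finset.bigcupP; exists d => //; rewrite inE; apply/ffun_onP => i.
by have := H i; rewrite negbK.
Qed.

(** * Families of locally sparse graphs that no small relation describes *)

Definition edge_hom (T T' : finType) (G : sgraph T) (H : sgraph T')
    (h : T -> T') : Prop :=
  forall x y, adj G x y -> adj H (h x) (h y).

Lemma edgeP (T : finType) (G : sgraph T) (E : {set T}) :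
  E \in val G -> exists x y, E = [set x; y]%SET /\ adj G x y.
Proof.
case: G => S cardS; rewrite /adj /= => ES.
have /cards2P[x [y [_ eqE]]] := forall_inP cardS _ ES.
by exists x, y; rewrite -eqE.
Qed.

(** The number of drawn pairs that fall inside the image of h; it bounds the
    number of edges spanned by this image. *)
Definition index_hits (k n M : nat) (h : 'I_k -> 'I_n)
    (e : {ffun 'I_M -> 'I_n * 'I_n}) : nat :=
  #|[set i | e i \in finset.setX [set h x | x : 'I_k] [set h x | x : 'I_k]]%SET|.

Lemma card_edges_hits (k n M : nat) (h : 'I_k -> 'I_n)
    (e : {ffun 'I_M -> 'I_n * 'I_n}) (H : sgraph 'I_k) :
  injective h -> edge_hom H (graph_of_pairs e) h ->
  (#|val H| <= index_hits h e)%N.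
Proof.
move=> h_inj hom; rewrite -(card_imset _ (imset_inj h_inj)).
pose hit := [set i | e i \in
  finset.setX [set h x | x : 'I_k] [set h x | x : 'I_k]]%SET.
apply: (@leq_trans #|[set [set (e i).1; (e i).2] | i in hit]%SET|); last first.
  exact: leq_imset_card.
apply: subset_leq_card; apply/fintype.subsetP => _ /imsetP[E EH ->].
have [x [y [-> /hom /imsetP [i neq eq_hxy]]]] := edgeP EH.
rewrite imsetU1 imset_set1 eq_hxy; apply: imset_f.
rewrite /hit inE [e i]surjective_pairing finset.in_setX.
have := set21 (e i).1 (e i).2; have := set22 (e i).1 (e i).2.
rewrite -eq_hxy !in_set2.
by move=> /orP[]/eqP -> /orP[]/eqP ->; rewrite !imset_f.
Qed.

(** Union bound over the n^k maps h.  The numerical hypothesis says that a given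
    image receives T pairs with probability at most n^(-2k), so that the sum over
    h is at most n^(-k) <= n^(-2), which leaves room for the later sum over k. *)
Lemma card_overcrowded (n M k T : nat) :
  (2 <= k)%N ->
  ((4 * M * k ^ 2) ^ T * n ^ (2 * k) <= (T * n ^ 2) ^ T)%N -> (0 < T * n)%N ->
  (#|\bigcup_(h : {ffun 'I_k -> 'I_n})
      [set e : {ffun 'I_M -> 'I_n * 'I_n} | T <= index_hits h e]%SET| * n ^ 2
    <= (n ^ 2) ^ M)%N.
Proof.
move=> k_ge2 num; rewrite muln_gt0 => /andP[T_gt0 n_gt0].
have cardT : #|({: 'I_n * 'I_n})| = (n ^ 2)%N by rewrite card_prod card_ord.
have one (h : {ffun 'I_k -> 'I_n}) :
    (#|[set e : {ffun 'I_M -> 'I_n * 'I_n} | T <= index_hits h e]%SET|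
      * n ^ (2 * k) <= (n ^ 2) ^ M)%N.
  set A := finset.setX [set h x | x : 'I_k]%SET [set h x | x : 'I_k]%SET.
  have cardA : (#|A| <= k ^ 2)%N.
    rewrite finset.cardsX; have le : (#|[set h x | x : 'I_k]%SET| <= k)%N.
      by rewrite (leq_trans (leq_imset_card _ _)) ?card_ord.
    exact: (leq_mul le le).
  have := card_many_hits_le M A T; rewrite cardT.
  set c := #|_|; move=> hits.
  have X_gt0 : (0 < (T * n ^ 2) ^ T)%N.
    by rewrite expn_gt0 muln_gt0 T_gt0 expn_gt0 n_gt0.
  rewrite -(leq_pmul2l X_gt0) mulnA [(_ * c)%N]mulnC.
  apply: leq_trans (leq_mul hits (leqnn _)) _.
  rewrite mulnAC [leqLHS]mulnC [leqRHS]mulnC leq_mul2l; apply/orP; right.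
  apply: leq_trans num; rewrite leq_mul2r; apply/orP; right.
  by apply: leq_expl; rewrite leq_mul2l cardA orbT.
have N_gt0 : (0 < n ^ k)%N by rewrite expn_gt0 n_gt0.
apply: (@leq_trans (#|\bigcup_(h : {ffun 'I_k -> 'I_n})
  [set e : {ffun 'I_M -> 'I_n * 'I_n} | T <= index_hits h e]%SET| * n ^ k)%N).
  by rewrite leq_mul2l leq_pexp2l ?orbT.
rewrite -(leq_pmul2r N_gt0) -mulnA -expnD addnn -mul2n.
apply: leq_trans (leq_mul (leq_card_bigcup _ _) (leqnn _)) _.
rewrite big_distrl /=; apply: leq_trans (leq_sum _ (fun h _ => one h)) _.
by rewrite sum_nat_const card_ffun !card_ord mulnC.
Qed.

(** The first-moment argument.  Overcrowded sequences make up at most a quarter of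
    all sequences, and so do those described by a given D; avoiding_family
    applies to the remaining three quarters. *)
Lemma sparse_unencodable_family (n M u k0 : nat) (t : nat -> nat) :
  (0 < u)%N -> (5 <= n)%N -> (2 <= k0)%N ->
  (4 * (u ^ n * (2 * M + n) ^ M) <= (n ^ 2) ^ M)%N ->
  (forall k, k0 <= k <= n ->
    (4 * M * k ^ 2) ^ (t k).+1 * n ^ (2 * k) <= ((t k).+1 * n ^ 2) ^ (t k).+1)%N ->
  exists F : {set sgraph 'I_n},
    [/\ (#|F| <= u ^ 2)%N,
        forall G, G \in F -> forall k (h : 'I_k -> 'I_n) (H : sgraph 'I_k),
          (k0 <= k)%N -> injective h -> edge_hom H G h -> (#|val H| <= t k)%N &
        forall D : {ffun 'I_u * 'I_u -> bool}, exists2 G, G \in F &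
          forall h, ~~ encodes D h G].
Proof.
move=> u_gt0 n_ge5 k0_ge2 num_u num_t.
have n_gt0 : (0 < n)%N by apply: leq_trans n_ge5.
set N := ((n ^ 2) ^ M)%N in num_u.
have N_gt0 : (0 < N)%N by rewrite !expn_gt0 n_gt0.
pose dense k := (\bigcup_(h : {ffun 'I_k -> 'I_n})
  [set e : {ffun 'I_M -> 'I_n * 'I_n} | (t k).+1 <= index_hits h e]%N)%SET.
pose bad := (\bigcup_(k < n.+1 | (k0 <= k)%N) dense k)%SET.
have card_bad : (4 * #|bad| <= N)%N.
  have n2_gt0 : (0 < n ^ 2)%N by rewrite expn_gt0 n_gt0.
  rewrite -(leq_pmul2r n2_gt0) -mulnA.
  have : (#|bad| * n ^ 2 <= n.+1 * N)%N.
    apply: leq_trans (leq_mul (leq_card_bigcup _ _) (leqnn _)) _.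
    rewrite big_distrl /=.
    apply: (@leq_trans (\sum_(k < n.+1) N)%N); last first.
      by rewrite sum_nat_const card_ord.
    rewrite big_mkcond; apply: leq_sum => k _; case: ifP => // k0k.
    apply: card_overcrowded; first exact: leq_trans k0k.
      by apply: num_t; rewrite k0k -ltnS ltn_ord.
    by rewrite muln_gt0.
  have : (4 * n.+1 <= n ^ 2)%N by rewrite expnS expn1; nia.
  by move: (n ^ 2)%N (#|bad|) => n2 b le1 le2; clearbody N; nia.
pose good := (~: bad)%SET.
have card_good : (#|bad| + #|good| = N)%N.
  by rewrite cardsC card_ffun card_prod !card_ord.
pose undone (D : {ffun 'I_u * 'I_u -> bool}) :=
  [set e : {ffun 'I_M -> 'I_n * 'I_n} |
    [exists h, encodes D h (graph_of_pairs e)]]%SET.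
have [||D||F Fgood Fnot] := @avoiding_family _ _ good undone (u ^ 2)%N
    (u ^ n * (2 * M + n) ^ M)%N.
- by rewrite expn_gt0 u_gt0.
- by rewrite card_ffun card_prod !card_ord card_bool.
- exact: card_encodable.
- by move: card_bad card_good num_u N_gt0; move: (u ^ n * _)%N => X; lia.
exists [set graph_of_pairs (F i) | i : 'I_(u ^ 2)]%SET; split.
- by apply: leq_trans (leq_imset_card _ _) _; rewrite card_ord.
- move=> _ /imsetP[i _ ->] k h H k0k h_inj hom.
  have kn : (k <= n)%N by have := leq_card h h_inj; rewrite !card_ord.
  have h_inj' : injective (finfun h) by move=> x y; rewrite !ffunE; apply: h_inj.
  have hom' : edge_hom H (graph_of_pairs (F i)) (finfun h).
    by move=> x y /hom; rewrite !ffunE.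
  apply: leq_trans (card_edges_hits h_inj' hom') _.
  have := Fgood i; rewrite /good /bad inE => /finset.bigcupP Fi.
  rewrite leqNgt; apply/negP => many; apply: Fi.
  have kn1 : (k < n.+1)%N by [].
  exists (Ordinal kn1) => //; apply/finset.bigcupP; exists (finfun h) => //.
  by rewrite inE.
- move=> D; have [i Fi] := Fnot D; exists (graph_of_pairs (F i)).
    exact: imset_f.
  by move=> h; apply: contra Fi => enc; rewrite inE; apply/existsP; exists h.
Qed.

(** * The class of subgraphs of a sequence of families, and its speed *)

(** Graphs with few edges are counted through sequences of pairs as well; spare
    positions are filled with the loop at vertex 0, which adds no edge. *)
Lemma sgraph_of_few_pairs (k t : nat) (H : sgraph 'I_k.+1) :
  (#|val H| <= t)%N ->
  exists e : {ffun 'I_t -> 'I_k.+1 * 'I_k.+1}, graph_of_pairs e = H.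
Proof.
move=> few.
pose ends (E : {set 'I_k.+1}) : 'I_k.+1 * 'I_k.+1 :=
  odflt (ord0, ord0) [pick xy | E == [set xy.1; xy.2]%SET].
pose e := [ffun i : 'I_t => ends (nth finset.set0 (enum (val H)) i)].
have endsP E : E \in val H -> [set (ends E).1; (ends E).2]%SET = E.
  move=> /edgeP[x [y [-> _]]]; rewrite /ends; case: pickP => [xy /eqP -> //|].
  by move=> /(_ (x, y)); rewrite eqxx.
exists e; apply: val_inj; apply/finset.setP => E /=; apply/imsetP/idP => [[i]|EH].
  rewrite inE ffunE => neq ->.
  have [lt_i|ge_i] := ltnP i (size (enum (val H))).
    have := mem_nth finset.set0 lt_i; rewrite mem_enum => iH.
    by rewrite endsP.
  move: neq; rewrite nth_default // /ends; case: pickP => [xy|]; rewrite ?eqxx //=.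
  by move=> /eqP/finset.setP/(_ xy.1); rewrite !inE eqxx.
have := EH; rewrite -mem_enum -index_mem => lt_E.
have lt_t : (index E (enum (val H)) < t)%N.
  by apply: leq_trans lt_E _; rewrite -cardE.
have eqE : nth finset.set0 (enum (val H)) (index E (enum (val H))) = E.
  by rewrite nth_index ?mem_enum.
exists (Ordinal lt_t); last by rewrite ffunE /= eqE endsP.
rewrite inE ffunE /= eqE; have [x [y [eqxy xyH]]] := edgeP EH.
have := endsP _ EH => eq_ends; apply/negP => /eqP same.
have := congr1 (fun S : {set 'I_k.+1} => #|S|) eq_ends.
by rewrite /= eqxy -eqxy same finset.setUid cards1 eqxy cards2 (adj_neq xyH).
Qed.

Lemma card_few_edges (k t : nat) : (0 < k)%N ->
  (#|[set H : sgraph 'I_k | #|val H| <= t]%SET| <= (k ^ 2) ^ t)%N.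
Proof.
case: k => // k _.
apply: (@leq_trans
  #|[set graph_of_pairs e | e : {ffun 'I_t -> 'I_k.+1 * 'I_k.+1}]%SET|).
  apply: subset_leq_card; apply/fintype.subsetP => H; rewrite inE.
  by move=> /sgraph_of_few_pairs[e <-]; apply: imset_f.
apply: leq_trans (leq_imset_card _ _) _.
by rewrite card_ffun card_prod !card_ord.
Qed.

Definition subgraphs_along (k n : nat) (G : sgraph 'I_n) (h : 'I_k -> 'I_n) :
    {set sgraph 'I_k} :=
  [set H : sgraph 'I_k |
    [forall x, forall y, adj H x y ==> adj G (h x) (h y)]]%SET.

Lemma subgraphs_alongP (k n : nat) (G : sgraph 'I_n) (h : 'I_k -> 'I_n) H :
  reflect (edge_hom H G h) (H \in subgraphs_along G h).
Proof.
rewrite inE; apply: (iffP forallP) => [hom x y xy|hom x].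
  by have /forallP/(_ y) := hom x; rewrite xy.
by apply/forallP => y; apply/implyP => /hom.
Qed.

(** The subgraphs of G along h are the graphs contained in the pull-back of G by
    h.  The pull-back is one of them, whence the bound t on its edges. *)
Lemma card_subgraphs_along (k n t : nat) (G : sgraph 'I_n) (h : 'I_k -> 'I_n) :
  (forall H, edge_hom H G h -> #|val H| <= t)%N ->
  (#|subgraphs_along G h| <= 2 ^ t)%N.
Proof.
move=> sparse.
pose E0 := [set E : {set 'I_k} | (#|E| == 2) && (h @: E \in val G)]%SET.
have E0P : [forall E in E0, #|E| == 2%N].
  by apply/forall_inP => E; rewrite inE => /andP[].
pose H0 : sgraph 'I_k := exist _ E0 E0P.
have hom0 : edge_hom H0 G h.
  by move=> x y; rewrite /adj /= inE imsetU1 imset_set1 => /andP[].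
apply: (@leq_trans (2 ^ #|val H0|)); last by rewrite leq_pexp2l ?sparse.
rewrite -card_powerset -(card_imset _ val_inj); apply: subset_leq_card.
apply/fintype.subsetP => _ /imsetP[H /subgraphs_alongP hom ->].
rewrite powersetE; apply/fintype.subsetP => E EH.
have [x [y [eqE xyH]]] := edgeP EH; rewrite inE eqE imsetU1 imset_set1.
by rewrite cards2 (adj_neq xyH); apply: hom.
Qed.

Definition subgraph_of_family (F : forall n, {set sgraph 'I_n}) (n0 : nat)
    (T : finType) (G : sgraph T) : Prop :=
  exists n, (n0 <= n)%N /\ exists2 G', G' \in F n & subgraph G G'.

Lemma subgraph_trans (T T' T'' : finType)
    (G : sgraph T) (G' : sgraph T') (G'' : sgraph T'') :
  subgraph G G' -> subgraph G' G'' -> subgraph G G''.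
Proof.
move=> [h h_inj hom] [h' h'_inj hom']; exists (h' \o h); first exact: inj_comp.
by move=> x y /hom /hom'.
Qed.

Lemma isomorphic_subgraph (T T' : finType) (G : sgraph T) (H : sgraph T') :
  isomorphic G H -> subgraph H G.
Proof.
move=> [h [g hK gK] adjE]; exists g; first exact: can_inj gK.
by move=> x y; rewrite -adjE !gK.
Qed.

Lemma subgraph_of_family_mono F n0 (T T' : finType) (G : sgraph T) (H : sgraph T') :
  subgraph H G -> subgraph_of_family F n0 G -> subgraph_of_family F n0 H.
Proof.
move=> HG [n [n0n [G' G'F GG']]]; exists n; split => //; exists G' => //.
exact: subgraph_trans HG GG'.
Qed.

Definition family_class (F : forall n, {set sgraph 'I_n}) (n0 : nat) : graph_class :=
  GraphClass (fun T T' (G : sgraph T) (H : sgraph T') GH =>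
    subgraph_of_family_mono (F := F) (n0 := n0) (isomorphic_subgraph GH)).

Lemma family_class_monotone F n0 : monotone_class (family_class F n0).
Proof. by move=> T T' G H; apply: subgraph_of_family_mono. Qed.

(** The speed vanishes nowhere, as it has to in order to be a power of 2: every
    edgeless graph embeds in a large enough host. *)
Lemma speed_family_class_gt0 (F : forall n, {set sgraph 'I_n}) n0 k :
  (forall n, (n0 <= n)%N -> exists G, G \in F n) ->
  (0 < speed (family_class F n0) k)%N.
Proof.
move=> F_ne; apply/card_gt0P.
have E0P : [forall E in (finset.set0 : {set {set 'I_k}}), #|E| == 2%N].
  by apply/forall_inP => E; rewrite inE.
pose H0 : sgraph 'I_k := exist _ finset.set0 E0P.
exists H0; rewrite inE; apply/asboolP.
have [G GF] := F_ne (maxn n0 k) (leq_maxl _ _).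
exists (maxn n0 k); split; first exact: leq_maxl.
exists G => //; exists (widen_ord (leq_maxr n0 k)).
  by move=> x y /(congr1 val) /= /val_inj.
by move=> x y; rewrite /adj /= inE.
Qed.

(** Graphs with a host on more than k^2 vertices are counted by their number of
    edges alone, since infinitely many hosts are in question; the others by
    host, embedding and set of edges. *)
Lemma speed_family_class (F : forall n, {set sgraph 'I_n}) (n0 k t1 t2 : nat)
    (a : nat -> nat) :
  (0 < k)%N ->
  (forall n, (n0 <= n)%N -> #|F n| <= a n)%N ->
  (forall n, (n0 <= n)%N -> forall G, G \in F n ->
    forall (h : 'I_k -> 'I_n) (H : sgraph 'I_k), injective h -> edge_hom H G h ->
    (#|val H| <= if k ^ 2 < n then t2 else t1)%N) ->
  (speed (family_class F n0) k
    <= (k ^ 2) ^ t2 + \sum_(k <= n < (k ^ 2).+1) a n * (n ^ k * 2 ^ t1))%N.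
Proof.
move=> k_gt0 Fa sparse.
pose dense := (\bigcup_(n < (k ^ 2).+1 | ((k <= n) && (n0 <= n))%N)
  \bigcup_(G in F n) \bigcup_(h : {ffun 'I_k -> 'I_n} | injectiveb h)
    subgraphs_along G h)%SET.
have sub : class_at (family_class F n0) k \subset
    [set H : sgraph 'I_k | (#|val H| <= t2)%N]%SET :|: dense.
  apply/fintype.subsetP => H; rewrite [in X in X -> _]inE.
  move=> /asboolP[n [n0n [G GF [h h_inj hom]]]].
  have kn : (k <= n)%N by have := leq_card h h_inj; rewrite !card_ord.
  rewrite inE; have := sparse _ n0n _ GF h H h_inj hom.
  case: ltnP => [_ few|n_le _]; first by rewrite inE few.
  apply/orP; right; apply/finset.bigcupP.
  exists (Ordinal (n_le : (n < (k ^ 2).+1)%N)); first by rewrite /= kn.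
  apply/finset.bigcupP; exists G => //; apply/finset.bigcupP; exists (finfun h).
    by apply/injectiveP => x y; rewrite !ffunE; apply: h_inj.
  by apply/subgraphs_alongP => x y /hom; rewrite !ffunE.
apply: leq_trans (subset_leq_card sub) _.
apply: leq_trans (leq_card_setU _ _) _; apply: leq_add.
  exact: card_few_edges.
apply: leq_trans (leq_card_bigcup _ _) _.
rewrite big_geq_mkord big_mkcondr; apply: leq_sum => n /= kn.
case: ifP => // n0n.
apply: leq_trans (leq_card_bigcup _ _) _.
apply: (@leq_trans (\sum_(G in F n) n ^ k * 2 ^ t1)%N); last first.
  by rewrite sum_nat_const leq_mul2r Fa ?orbT.
apply: leq_sum => G GF; apply: leq_trans (leq_card_bigcup _ _) _.
apply: (@leq_trans (\sum_(h : {ffun 'I_k -> 'I_n}) 2 ^ t1)%N); last first.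
  by rewrite sum_nat_const card_ffun !card_ord.
rewrite big_mkcond; apply: leq_sum => h _; case: injectiveP => // h_inj.
apply: card_subgraphs_along => H hom.
have := sparse _ n0n _ GF h H h_inj hom.
by rewrite ltnNge (_ : (n <= k ^ 2)%N) // -ltnS ltn_ord.
Qed.

(** * Growth of decent functions *)

Lemma natrX_expR (R : realType) (n m : nat) : (0 < n)%N ->
  n%:R ^+ m = expR (m%:R * ln n%:R) :> R.
Proof. by move=> n_gt0; rewrite expRM_natl lnK // posrE ltr0n. Qed.

Lemma log_le_power (R : realType) (A eps : R) : 0 < eps ->
  exists x0 : R, forall x, x0 <= x -> [/\ 1 <= ln x, A <= expR (eps * ln x)
    & A * ln x <= expR (eps * ln x)].
Proof.
move=> eps_gt0.
(* The exponential is at least (eps y / 2)^2, so y >= 4 |A| / eps^2 is enough. *)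
pose y0 : R := 1 + 4 * `|A| / eps ^+ 2.
have y0_ge1 : 1 <= y0.
  by rewrite lerDl; apply: divr_ge0; rewrite ?sqr_ge0 // mulr_ge0.
exists (expR y0) => x x0x.
have x_gt0 : 0 < x by apply: lt_le_trans x0x; apply: expR_gt0.
have y0y : y0 <= ln x by rewrite -(expRK y0) ler_ln // posrE ?expR_gt0.
set y := ln x in y0y *.
have y_ge1 : 1 <= y by apply: le_trans y0y.
suff Ay : `|A| * y <= expR (eps * y).
  split => //.
    apply: le_trans Ay; apply: (le_trans (ler_norm A)).
    by rewrite ler_peMr.
  apply: le_trans Ay; apply: ler_wpM2r; first lra.
  exact: ler_norm.
have half : eps * y = eps * y / 2 + eps * y / 2 by lra.
rewrite {}half expRD.
have e1 : eps * y / 2 <= expR (eps * y / 2).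
  by apply: le_trans (expR_ge1Dx _); rewrite lerDr.
have e0 : 0 <= eps * y / 2 by rewrite divr_ge0 // mulr_ge0 //; lra.
apply: le_trans (ler_pM e0 e0 e1 e1).
have : 4 * `|A| / eps ^+ 2 <= y by apply: le_trans y0y; rewrite lerDr.
rewrite ler_pdivrMr ?exprn_gt0 // => h.
have := ler_wpM2r (_ : 0 <= y) h; rewrite expr2 => h'.
have y_ge0 : 0 <= y by lra.
have := h' y_ge0; nra.
Qed.

Definition growth (R : realType) (delta C s : R) (f : R -> R) : Prop :=
  [/\ 0 < delta < 1, 1 <= C, 2 <= s & decent_with delta C s f].

Lemma growth_ge0 (R : realType) (delta C s : R) (f : R -> R) (x : R) :
  growth delta C s f -> 0 <= x -> 0 <= f x.
Proof. by move=> [_ _ _ [h _ _ _]]; apply: h. Qed.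

Lemma growth_mono (R : realType) (delta C s : R) (f : R -> R) (x y : R) :
  growth delta C s f -> 0 <= x -> x <= y -> f x <= f y.
Proof. by move=> [_ _ _ [_ h _ _]]; apply: h. Qed.

Lemma growth_submul (R : realType) (delta C s : R) (f : R -> R) (x y : R) :
  growth delta C s f -> s <= x -> s <= y -> f (x * y) <= C * f x * f y.
Proof. by move=> [_ _ _ [_ _ _ h]]; apply: h. Qed.

Lemma growth_le (R : realType) (delta C s : R) (f : R -> R) (x : R) :
  growth delta C s f -> s <= x -> f x <= C * expR ((1 - delta) * ln x).
Proof.
move=> [_ _ s_ge2 [_ _ /(_ x) h _]] sx; have [_] := h sx.
have x_gt0 : 0 < x by lra.
by rewrite /powR gt_eqF.
Qed.

Lemma growth_ge (R : realType) (delta C s : R) (f : R -> R) (x : R) :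
  growth delta C s f -> s <= x -> ln x <= f x /\ 1 <= f x.
Proof.
move=> [_ _ s_ge2 [_ _ /(_ x) h _]] sx; have [+ _] := h sx; rewrite /log2.
have ln2_gt0 : 0 < ln 2 :> R by rewrite ln_gt0 // ltr1n.
have ln2_le1 : ln 2 <= 1 :> R.
  by have := @le_ln1Dx R 1; rewrite (_ : 1 + 1 = 2) //; apply; lra.
have lnx : ln 2 <= ln x by rewrite ler_ln ?posrE; lra.
move=> le_f; split; apply: le_trans le_f.
  by rewrite ler_pdivlMr // ler_piMr //; lra.
by rewrite ler_pdivlMr // mul1r.
Qed.

(** Sub-multiplicativity applied to y = x (y/x), followed by the upper bound on
    f (y/x). *)
Lemma growth_far (R : realType) (delta C s : R) (f : R -> R) (x y : R) :
  growth delta C s f -> s <= x -> s <= y / x ->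
  f y <= C ^+ 2 * f x * expR ((1 - delta) * (ln y - ln x)).
Proof.
move=> gf sx syx; have [_ C_ge1 s_ge2 _] := gf.
have x_gt0 : 0 < x by lra.
have y_gt0 : 0 < y.
  have : 0 < y / x by lra.
  by rewrite pmulr_lgt0 // invr_gt0.
have -> : f y = f (x * (y / x)) by rewrite mulrCA divff ?mulr1 // gt_eqF.
apply: le_trans (growth_submul gf sx syx) _.
have := growth_le gf syx; rewrite ln_div ?posrE // => le_q.
have fx : 0 <= C * f x by rewrite mulr_ge0 ?(growth_ge0 gf) //; lra.
apply: le_trans (ler_wpM2l fx le_q) _.
by rewrite le_eqVlt; apply/orP; left; apply/eqP; ring.
Qed.

(** Up to a constant, f x / x does not increase.  For y >= s x this is
    growth_far; for y < s x monotonicity gives f y <= f (s x) <= C f s f x. *)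
Lemma growth_per_vertex (R : realType) (delta C s : R) (f : R -> R) (x y : R) :
  growth delta C s f -> s <= x -> x <= y ->
  x * f y <= (C ^+ 2 + C * f s) * y * f x.
Proof.
move=> gf sx xy; have [/andP[delta_gt0 delta_lt1] C_ge1 s_ge2 _] := gf.
have x_gt0 : 0 < x by lra.
have y_gt0 : 0 < y by lra.
have fx := growth_ge0 gf (ltW x_gt0).
have s_ge0 : 0 <= s by lra.
have fs : 0 <= C * f s by rewrite mulr_ge0 ?(growth_ge0 gf) //; lra.
have yfx : 0 <= y * f x by rewrite mulr_ge0 // ltW.
have [syx|yxs] := leP s (y / x).
  have := growth_far gf sx syx.
  have : expR ((1 - delta) * (ln y - ln x)) <= y / x.
    rewrite -[y / x]lnK ?posrE ?divr_gt0 // ler_expR ln_div ?posrE //.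
    have : ln x <= ln y by rewrite ler_ln.
    by nra.
  set q := expR _ => q_le fy_le.
  have : x * f y <= C ^+ 2 * (y * f x).
    have -> : C ^+ 2 * (y * f x) = x * (C ^+ 2 * f x * (y / x)).
      by field; rewrite gt_eqF.
    rewrite ler_pM2l //; apply: le_trans fy_le _.
    by rewrite ler_wpM2l // mulr_ge0 // sqr_ge0.
  by nra.
have y_le : y <= s * x by rewrite -ler_pdivrMr // ltW.
have fy_le : f y <= C * f s * f x.
  by apply: le_trans (growth_mono gf (ltW y_gt0) y_le) (growth_submul gf _ _).
have : x * f y <= y * (C * f s * f x).
  by apply: ler_pM => //; [exact: ltW|exact: growth_ge0 gf (ltW y_gt0)].
have : 0 <= C ^+ 2 * (y * f x) by rewrite mulr_ge0 // sqr_ge0.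
by nra.
Qed.

(** * Local sparsity of random graphs with n f(n) edges *)

(** The integer part of n^f(n), that is, the largest size allowed for a universal
    graph. *)
Definition host_size (R : realType) (f : R -> R) (n : nat) : nat :=
  Num.truncn (expR (f n%:R * ln n%:R)).

(** The constant 4/delta is such that (n^(-delta/2))^M <= u^(-2n) for u = n^f(n).
    The left-hand side bounds the probability that the graph is described by a
    given map, and there are u^n maps. *)
Definition edge_number (R : realType) (delta : R) (f : R -> R) (n : nat) : nat :=
  (Num.truncn (4 / delta * (n%:R * f n%:R))).+1.

(** The constant 8/delta is such that a factor n^(-delta/4) for each of
    sparse_bound k + 1 >= 8k/delta edges amounts to at most n^(-2k). *)
Definition sparse_bound (R : realType) (delta : R) (f : R -> R) (k : nat) : nat :=
  Num.truncn (8 / delta * (k%:R * f k%:R / ln k%:R)).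

(** For k <= n, the mean number M k^2 / n^2 of pairs falling inside k vertices is
    smaller than dense_bound k + 1 by a factor of at least 4e.  By
    card_many_hits_le, each pair then contributes a factor 1/e to the
    probability of having so many. *)
Definition dense_bound (R : realType) (delta C s : R) (f : R -> R) (k : nat) : nat :=
  Num.truncn (32 / delta * (C ^+ 2 + C * f s) * expR 1 * (k%:R * f k%:R)).

(** Logarithmic form of the requirement of card_overcrowded: if each pair
    contributes at most a factor exp(-rho) and rho T >= 2k ln n, then the
    probability is at most n^(-2k). *)
Lemma hits_bound_expR (R : realType) (rho : R) (n k M T : nat) : (0 < n)%N ->
  4 * M%:R * k%:R ^+ 2 <= expR (- rho) * (T%:R * n%:R ^+ 2) ->
  2 * k%:R * ln n%:R <= rho * T%:R ->
  ((4 * M * k ^ 2) ^ T * n ^ (2 * k) <= (T * n ^ 2) ^ T)%N.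
Proof.
move=> n_gt0 ratio rho_big; rewrite -(ler_nat R).
rewrite !(natrM, natrX) (natrX_expR R (2 * k) n_gt0) natrM.
have lhs_ge0 : 0 <= 4%:R * M%:R * k%:R ^+ 2 :> R.
  by rewrite !mulr_ge0 // exprn_ge0.
apply: (@le_trans _ _ ((expR (- rho) * (T%:R * n%:R ^+ 2)) ^+ T *
                       expR (2%:R * k%:R * ln n%:R))).
  apply: ler_wpM2r; first exact: expR_ge0.
  apply: lerXn2r => //; rewrite nnegrE //.
rewrite exprMn -expRM_natl mulrAC -expRD.
apply: ler_piMl; first by rewrite exprn_ge0 // mulr_ge0 // exprn_ge0.
rewrite -[leRHS]expR0 ler_expR; lra.
Qed.

Lemma edge_number_bounds (R : realType) (delta C s : R) (f : R -> R) (n : nat) :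
  growth delta C s f -> s <= n%:R ->
  4 / delta * (n%:R * f n%:R) <= (edge_number delta f n)%:R
    <= 8 / delta * (n%:R * f n%:R).
Proof.
move=> gf sn; have [/andP[delta_gt0 delta_lt1] C_ge1 s_ge2 _] := gf.
have [_ f_ge1] := growth_ge gf sn.
have c_ge : 4 <= 4 / delta by rewrite ler_pdivlMr //; lra.
have nf : 1 <= n%:R * f n%:R by nra.
have big : 1 <= 4 / delta * (n%:R * f n%:R) by nra.
have : 0 <= 4 / delta * (n%:R * f n%:R) by lra.
move=> /truncn_itv; rewrite /edge_number => /andP[le_t lt_t].
rewrite (ltW lt_t) /=.
have -> : 8 / delta * (n%:R * f n%:R) =
  4 / delta * (n%:R * f n%:R) + 4 / delta * (n%:R * f n%:R) by ring.
by rewrite -(natr1 (Num.truncn _)); apply: lerD.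
Qed.

(** Here ln n <= 2 ln k <= 2 f(k), so that a constant gain per edge over
    O(k f(k)) edges is already n^(-2k). *)
Lemma dense_regime (R : realType) (delta C s : R) (f : R -> R) (k n : nat) :
  growth delta C s f -> s <= k%:R -> (k <= n <= k ^ 2)%N ->
  forall T, T = (dense_bound delta C s f k).+1 ->
  ((4 * edge_number delta f n * k ^ 2) ^ T * n ^ (2 * k) <= (T * n ^ 2) ^ T)%N.
Proof.
move=> gf sk /andP[kn nk2] T eqT; have [/andP[delta_gt0 delta_lt1] C_ge1 s_ge2 _] := gf.
have knR : k%:R <= n%:R :> R by rewrite ler_nat.
have k_gt0 : 0 < k%:R :> R by lra.
have n_gt0 : 0 < n%:R :> R by lra.
have n_gt0' : (0 < n)%N by rewrite ltr0n in n_gt0.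
have k_gt0' : (0 < k)%N by rewrite ltr0n in k_gt0.
have [lnk_le fk_ge1] := growth_ge gf sk.
have sn : s <= n%:R by lra.
have /andP[_ M_le] := edge_number_bounds gf sn.
have per := growth_per_vertex gf sk knR.
set K1 := C ^+ 2 + C * f s in per.
have K1_ge1 : 1 <= K1.
  have : 0 <= C * f s by rewrite mulr_ge0 ?(growth_ge0 gf) //; lra.
  by rewrite /K1; nra.
have e_gt0 := expR_gt0 (1 : R).
have e_ge2 : 2 <= expR 1 :> R by have := expR_ge1Dx (1 : R); lra.
have d_ge : 1 <= delta^-1 by rewrite invf_ge1 // ltW.
have kf : 0 < k%:R * f k%:R by rewrite mulr_gt0 //; lra.
set c1 := 32 / delta * K1 * expR 1.
have c1_ge : 64 <= c1.
  have h1 : 32 <= 32 / delta by lra.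
  have h2 : 32 <= 32 / delta * K1 by nra.
  by rewrite /c1; nra.
have T_ge : c1 * (k%:R * f k%:R) <= T%:R.
  have : 0 <= c1 * (k%:R * f k%:R) by nra.
  by rewrite eqT => /truncn_itv /andP[_ /ltW].
apply: (@hits_bound_expR R 1) => //.
  rewrite expRN.
  have : k%:R * (8 / delta * (k%:R * f n%:R) * 4) * n%:R <=
         k%:R * (8 / delta * (K1 * n%:R * f k%:R) * 4) * n%:R.
    apply: ler_wpM2r; first exact: ltW.
    apply: ler_wpM2l; first exact: ltW.
    apply: ler_wpM2r; first lra.
    by apply: ler_wpM2l => //; apply: divr_ge0; lra.
  move=> step.
  apply: (@le_trans _ _ (4 * (8 / delta * (n%:R * f n%:R)) * k%:R ^+ 2)).
    by apply: ler_wpM2r; [exact: exprn_ge0|apply: ler_wpM2l].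
  apply: (@le_trans _ _ (k%:R * (8 / delta * (k%:R * f n%:R) * 4) * n%:R)).
    by rewrite le_eqVlt; apply/orP; left; apply/eqP; ring.
  apply: le_trans step _.
  apply: (@le_trans _ _ ((expR 1)^-1 * (c1 * (k%:R * f k%:R) * n%:R ^+ 2))).
    rewrite le_eqVlt; apply/orP; left; apply/eqP; rewrite /c1.
    by field; rewrite !gt_eqF.
  apply: ler_wpM2l; first by rewrite invr_ge0 ltW.
  by apply: ler_wpM2r; [exact: exprn_ge0|].
rewrite mul1r; apply: le_trans T_ge.
have ln_n : ln n%:R <= 2 * ln k%:R :> R.
  rewrite -(_ : ln (k%:R ^+ 2) = 2 * ln k%:R :> R); last first.
    by rewrite lnXn // mulr_natl.
  rewrite ler_ln ?posrE //; last exact: exprn_gt0.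
  by rewrite -natrX ler_nat.
apply: (@le_trans _ _ (4 * (k%:R * f k%:R))); last first.
  by rewrite ler_pM2r //; lra.
have : k%:R * ln n%:R <= k%:R * (2 * f k%:R).
  by rewrite ler_pM2l //; lra.
lra.
Qed.

(** For n > k^2 the ratio k^2 f(n) / n to k f(k) / ln k is at most
    C^2 ln k (k/n)^delta <= C^2 ln n n^(-delta/2), which is below n^(-delta/4) / 4
    for large n. *)
Lemma sparse_regime (R : realType) (delta C s : R) (f : R -> R) :
  growth delta C s f -> exists x0 : R, forall k n : nat,
  s <= k%:R -> (k ^ 2 < n)%N -> x0 <= n%:R ->
  forall T, T = (sparse_bound delta f k).+1 ->
  ((4 * edge_number delta f n * k ^ 2) ^ T * n ^ (2 * k) <= (T * n ^ 2) ^ T)%N.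
Proof.
move=> gf; have [/andP[delta_gt0 delta_lt1] C_ge1 s_ge2 _] := gf.
have d4_gt0 : 0 < delta / 4 by lra.
have [x0 x0P] := log_le_power (4 * C ^+ 2) d4_gt0.
exists x0 => k n sk k2n x0n T eqT.
have [_ _ small] := x0P _ x0n.
have k_gt0 : 0 < k%:R :> R by lra.
have k_gt0' : (0 < k)%N by rewrite ltr0n in k_gt0.
have k2nR : k%:R ^+ 2 < n%:R :> R by rewrite -natrX ltr_nat.
have n_gt0 : 0 < n%:R :> R by apply: lt_trans k2nR; apply: exprn_gt0.
have n_gt0' : (0 < n)%N by rewrite ltr0n in n_gt0.
have skn : s <= n%:R / k%:R.
  rewrite ler_pdivlMr //; apply: le_trans (ltW k2nR).
  by rewrite expr2 ler_pM2r.
have sn : s <= n%:R by nra.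
have [lnk_le fk_ge1] := growth_ge gf sk.
have /andP[_ M_le] := edge_number_bounds gf sn.
have far := growth_far gf sk skn.
have lnk_gt0 : 0 < ln k%:R :> R by rewrite ln_gt0 //; lra.
have ln_n : 2 * ln k%:R <= ln n%:R :> R.
  rewrite -(_ : ln (k%:R ^+ 2) = 2 * ln k%:R :> R); last first.
    by rewrite lnXn // mulr_natl.
  by rewrite ler_ln ?posrE ?exprn_gt0 // ltW.
set Lk := ln k%:R in lnk_le far lnk_gt0 ln_n *.
set L := ln n%:R in small far ln_n *.
have d_ge : 1 <= delta^-1 by rewrite invf_ge1 // ltW.
set c2 := 8 / delta.
have c2_ge0 : 0 <= c2 by apply: divr_ge0; lra.
have T_ge : c2 * (k%:R * f k%:R / Lk) <= T%:R.
  have : 0 <= c2 * (k%:R * f k%:R / Lk).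
    by rewrite mulr_ge0 ?divr_ge0 ?mulr_ge0 //; lra.
  by rewrite eqT => /truncn_itv /andP[_ /ltW].
apply: (@hits_bound_expR R (delta / 4 * L)) => //.
  apply: (@le_trans _ _ (expR (- (delta / 4 * L)) *
     (c2 * (k%:R * f k%:R / Lk) * n%:R ^+ 2))); last first.
    apply: ler_wpM2l; first exact: expR_ge0.
    by apply: ler_wpM2r; [exact: exprn_ge0|].
  apply: (@le_trans _ _ (4 * (c2 * (n%:R * f n%:R)) * k%:R ^+ 2)).
    by apply: ler_wpM2r; [exact: exprn_ge0|apply: ler_wpM2l].
  apply: (@le_trans _ _ (4 * (c2 * (n%:R * (C ^+ 2 * f k%:R *
       expR ((1 - delta) * (L - Lk))))) * k%:R ^+ 2)).
    apply: ler_wpM2r; first exact: exprn_ge0.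
    apply: ler_wpM2l => //; apply: (ler_wpM2l c2_ge0).
    exact: (ler_wpM2l (ltW n_gt0) far).
  have kexp : k%:R = expR Lk :> R by rewrite lnK.
  have nexp : n%:R = expR L :> R by rewrite lnK.
  have key : 4 * C ^+ 2 * (Lk * expR ((1 - delta) * (L - Lk)) * k%:R)
      <= expR (- (delta / 4 * L)) * n%:R.
    rewrite kexp nexp -[Lk * _ * _]mulrA -!expRD.
    apply: (@le_trans _ _ (expR (delta / 4 * L) * expR (L - delta / 2 * L))).
      rewrite mulrA; apply: ler_pM.
      - by apply: mulr_ge0; [apply: mulr_ge0; rewrite ?sqr_ge0|exact: ltW].
      - exact: expR_ge0.
      - apply: le_trans small; apply: ler_wpM2l.
          by rewrite mulr_ge0 ?sqr_ge0.
        by lra.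
      - by rewrite ler_expR; nra.
    by rewrite -expRD ler_expR; lra.
  have -> : 4 * (c2 * (n%:R * (C ^+ 2 * f k%:R * expR ((1 - delta) * (L - Lk)))))
     * k%:R ^+ 2 = (c2 * n%:R * f k%:R * k%:R / Lk) *
     (4 * C ^+ 2 * (Lk * expR ((1 - delta) * (L - Lk)) * k%:R)).
    by field; rewrite !gt_eqF.
  have -> : expR (- (delta / 4 * L)) * (c2 * (k%:R * f k%:R / Lk) * n%:R ^+ 2) =
     (c2 * n%:R * f k%:R * k%:R / Lk) * (expR (- (delta / 4 * L)) * n%:R).
    by field; rewrite !gt_eqF.
  apply: ler_wpM2l key.
  by rewrite divr_ge0 ?mulr_ge0 //; lra.
have T_ge' : c2 * k%:R <= T%:R.
  apply: le_trans T_ge; apply: ler_wpM2l; first by apply: divr_ge0; lra.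
  by rewrite ler_pdivlMr // ler_pM2l.
have L_gt0 : 0 < L by lra.
apply: (@le_trans _ _ (delta / 4 * L * (c2 * k%:R))); last first.
  by apply: ler_wpM2l => //; rewrite mulr_ge0 ?divr_ge0 //; lra.
rewrite -/L le_eqVlt; apply/orP; left; apply/eqP; rewrite /c2.
by field; rewrite gt_eqF.
Qed.

(** * Numerical bounds for encodings and for the speed *)

Lemma host_size_le (R : realType) (f : R -> R) (n : nat) :
  (host_size f n)%:R <= expR (f n%:R * ln n%:R).
Proof. by rewrite truncn_le ltW // expR_gt0. Qed.

(** As (2M + n)/n^2 <= n^(-delta/2) for large n, the right-hand side exceeds the
    product on the left by the factor n^(n f(n)) at least, and so by 4. *)
Lemma few_encodings (R : realType) (delta C s : R) (f : R -> R) :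
  growth delta C s f -> exists x0 : R, forall n : nat, x0 <= n%:R ->
  (4 * (host_size f n ^ n * (2 * edge_number delta f n + n) ^ edge_number delta f n)
    <= (n ^ 2) ^ edge_number delta f n)%N.
Proof.
move=> gf; have [/andP[delta_gt0 delta_lt1] C_ge1 s_ge2 _] := gf.
have d2_gt0 : 0 < delta / 2 by lra.
have [x0 x0P] := log_le_power (20 / delta * C) d2_gt0.
exists (`|x0| + s + 4) => n xn.
have absx0 := ler_norm x0; have absx0' := normr_ge0 x0.
have x0n : x0 <= n%:R by lra.
have sn : s <= n%:R by lra.
have n_ge4 : 4 <= n%:R :> R by lra.
have [L_ge1 small _] := x0P _ x0n.
have n_gt0 : 0 < n%:R :> R by lra.
have [lnn_le fn_ge1] := growth_ge gf sn.
have f_le := growth_le gf sn.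
have /andP[M_ge M_le] := edge_number_bounds gf sn.
have u_le := host_size_le f n.
have nexp : n%:R = expR (ln n%:R) :> R by rewrite lnK.
have d_ge : 1 <= delta^-1 by rewrite invf_ge1 // ltW.
set M := edge_number delta f n in M_ge M_le *.
set L := ln n%:R in L_ge1 small lnn_le f_le u_le nexp.
set F := f n%:R in lnn_le fn_ge1 f_le M_ge M_le u_le.
have nF_ge1 : 1 <= n%:R * F by nra.
have base : 2 * M%:R + n%:R <= expR (- (delta / 2 * L)) * n%:R ^+ 2.
  have nF : n%:R * 1 <= n%:R * F by rewrite ler_pM2l.
  apply: (@le_trans _ _ (20 / delta * (n%:R * F))).
    have : 4 * (n%:R * F) <= 4 / delta * (n%:R * F).
      by apply: ler_wpM2r; lra.
    lra.
  apply: (@le_trans _ _ (20 / delta * (n%:R * (C * expR ((1 - delta) * L))))).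
    apply: ler_wpM2l; first by apply: divr_ge0; lra.
    by rewrite ler_pM2l.
  have -> : 20 / delta * (n%:R * (C * expR ((1 - delta) * L))) =
    20 / delta * C * (n%:R * expR ((1 - delta) * L)) by ring.
  apply: (@le_trans _ _ (expR (delta / 2 * L) * (n%:R * expR ((1 - delta) * L)))).
    by apply: ler_wpM2r => //; rewrite mulr_ge0 ?expR_ge0 // ltW.
  by rewrite expr2 nexp -!expRD ler_expR; lra.
rewrite -(ler_nat R) !(natrM, natrX, natrD).
have hu : (host_size f n)%:R ^+ n <= expR (n%:R * (F * L)).
  by rewrite expRM_natl; apply: lerXn2r; rewrite // nnegrE ?expR_ge0.
have hM : (2 * M%:R + n%:R) ^+ M <=
    expR (- (M%:R * (delta / 2 * L))) * (n%:R ^+ 2) ^+ M :> R.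
  rewrite -mulrN expRM_natl -exprMn.
  apply: lerXn2r; rewrite // nnegrE; last exact: le_trans base.
  by rewrite addr_ge0 // mulr_ge0.
apply: (@le_trans _ _ (expR L * (expR (n%:R * (F * L)) *
   (expR (- (M%:R * (delta / 2 * L))) * (n%:R ^+ 2) ^+ M)))).
  apply: ler_pM => //.
  - by rewrite -nexp.
  - exact: ler_pM.
rewrite !mulrA -!expRD; apply: ler_piMl; first by rewrite !exprn_ge0.
rewrite -[leRHS]expR0 ler_expR.
have : 2 * (n%:R * F * L) <= M%:R * (delta / 2 * L).
  have -> : 2 * (n%:R * F * L) = 4 / delta * (n%:R * F) * (delta / 2 * L).
    by field; rewrite gt_eqF.
  apply: ler_wpM2r => //; apply: mulr_ge0; lra.
have : 1 * L <= n%:R * F * L by apply: ler_wpM2r => //; lra.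
lra.
Qed.

(** Every factor is exp(O(k f(k))).  The one to watch is host_size n ^ 2 with
    n <= k^2: f(n) ln n <= 2 C f(k)^2 ln k, and f(k) ln k <= C k because
    ln k <= k^delta. *)
Lemma speed_bound_expR (R : realType) (delta C s : R) (f : R -> R) :
  growth delta C s f -> exists c x0 : R, 0 <= c /\ forall k : nat, x0 <= k%:R ->
  ((k ^ 2) ^ sparse_bound delta f k +
   \sum_(k <= n < (k ^ 2).+1)
     host_size f n ^ 2 * (n ^ k * 2 ^ dense_bound delta C s f k))%N%:R
  <= expR (c * (k%:R * f k%:R)).
Proof.
move=> gf; have [/andP[delta_gt0 delta_lt1] C_ge1 s_ge2 _] := gf.
have [x0 x0P] := log_le_power 1 delta_gt0.
have d_ge : 1 <= delta^-1 by rewrite invf_ge1 // ltW.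
pose c1 := 32 / delta * (C ^+ 2 + C * f s) * expR 1.
pose c2 := 8 / delta.
have s_ge0 : 0 <= s by lra.
have fs : 0 <= C * f s by rewrite mulr_ge0 ?(growth_ge0 gf) //; lra.
have C2_ge0 := sqr_ge0 C.
have c1_ge0 : 0 <= c1.
  apply: mulr_ge0; last exact: expR_ge0.
  by apply: mulr_ge0; [apply: divr_ge0|]; lra.
have c2_ge0 : 0 <= c2 by apply: divr_ge0; lra.
pose c_tot := 1 + 2 * c2 + (2 + 4 * C ^+ 2 + 2 + c1).
exists c_tot, (`|x0| + s).
split; first by rewrite /c_tot; lra.
move=> k xk.
have absx0 := ler_norm x0; have absx0' := normr_ge0 x0.
have x0k : x0 <= k%:R by lra.
have sk : s <= k%:R by lra.
have k_gt0 : 0 < k%:R :> R by lra.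
have k_gt0' : (0 < k)%N by rewrite ltr0n in k_gt0.
have [L_ge1 _ small] := x0P _ x0k.
have k_ge1 : (1 : R) <= k%:R by rewrite ler1n.
have [Lf f_ge1] := growth_ge gf sk.
have f_le := growth_le gf sk.
have f_k2 := growth_submul gf sk sk.
set L := ln k%:R in L_ge1 small Lf f_le.
have kexp : k%:R = expR L :> R by rewrite lnK.
set F := f k%:R in Lf f_ge1 f_le f_k2 *.
set S := k%:R * F.
have kL : k%:R * L <= S by rewrite ler_pM2l.
have S_ge1 : 1 <= S by rewrite /S; nra.
have L_S : L <= S by rewrite /S; nra.
have fL : F * L <= C * k%:R.
  have -> : C * k%:R = C * expR ((1 - delta) * L) * expR (delta * L).
    by rewrite -mulrA -expRD kexp; congr (_ * expR _); ring.
  by apply: ler_pM => //; lra.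
have sparse_part : (((k ^ 2) ^ sparse_bound delta f k)%N%:R : R) <= expR (2 * c2 * S).
  rewrite natrX natrX kexp -expRM_natl -expRM_natl ler_expR.
  have : 0 <= c2 * (k%:R * F / L).
    by rewrite mulr_ge0 // divr_ge0 ?mulr_ge0 //; lra.
  move=> /truncn_itv /andP[t_le _].
  have -> : 2 * c2 * S = c2 * (k%:R * F / L) * (2 * L).
    by rewrite /S; field; rewrite gt_eqF //; lra.
  by apply: ler_wpM2r => //; lra.
have dense_term n : (k <= n < (k ^ 2).+1)%N ->
    ((host_size f n ^ 2 * (n ^ k * 2 ^ dense_bound delta C s f k))%N%:R : R)
    <= expR ((4 * C ^+ 2 + 2 + c1) * S).
  move=> /andP[kn nk2].
  have n_gt0 : (0 < n)%N by apply: leq_trans kn.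
  have nR_gt0 : 0 < n%:R :> R by rewrite ltr0n.
  have nk2R : n%:R <= k%:R * k%:R :> R by rewrite -natrM ler_nat.
  have ln_n : ln n%:R <= 2 * L :> R.
    have -> : 2 * L = ln (k%:R * k%:R) by rewrite lnM ?posrE // /L; ring.
    by rewrite ler_ln ?posrE // mulr_gt0.
  have ln_n_ge0 : 0 <= ln n%:R :> R by rewrite ln_ge0 // ler1n.
  have fn_ge0 := growth_ge0 gf (ltW nR_gt0).
  have fn_le : f n%:R <= C * F * F.
    exact: le_trans (growth_mono gf (ltW nR_gt0) nk2R) f_k2.
  have fln : f n%:R * ln n%:R <= 2 * C ^+ 2 * S.
    apply: (@le_trans _ _ (C * F * F * (2 * L))); first exact: ler_pM.
    have -> : C * F * F * (2 * L) = (2 * C * F) * (F * L) by ring.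
    have -> : 2 * C ^+ 2 * S = (2 * C * F) * (C * k%:R) by rewrite /S; ring.
    apply: ler_wpM2l fL; apply: mulr_ge0; last by clear - f_ge1; lra.
    by clear - C_ge1; lra.
  rewrite !(natrM, natrX).
  have -> : (4 * C ^+ 2 + 2 + c1) * S =
    2 * (2 * C ^+ 2 * S) + (2 * S + c1 * S) by ring.
  rewrite !expRD; apply: ler_pM; rewrite ?mulr_ge0 ?exprn_ge0 //.
    rewrite expRM_natl; apply: lerXn2r; rewrite ?nnegrE ?expR_ge0 //.
    by apply: le_trans (host_size_le f n) _; rewrite ler_expR.
  apply: ler_pM; rewrite ?exprn_ge0 //.
    rewrite natrX_expR // ler_expR.
    have : k%:R * ln n%:R <= k%:R * (2 * L) by rewrite ler_pM2l.
    by clear - kL; lra.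
  apply: (@le_trans _ _ (expR 1 ^+ dense_bound delta C s f k)).
    apply: lerXn2r; rewrite ?nnegrE ?expR_ge0 //.
    by have := expR_ge1Dx (1 : R); clear; lra.
  rewrite -expRM_natl mulr1 ler_expR.
  have : 0 <= c1 * S by rewrite mulr_ge0 // (le_trans ler01).
  by move=> /truncn_itv /andP[].
have dense_part : ((\sum_(k <= n < (k ^ 2).+1) host_size f n ^ 2 *
    (n ^ k * 2 ^ dense_bound delta C s f k))%N%:R : R)
    <= expR ((2 + (4 * C ^+ 2 + 2 + c1)) * S).
  rewrite natr_sum.
  apply: (@le_trans _ _ (\sum_(k <= n < (k ^ 2).+1)
    expR ((4 * C ^+ 2 + 2 + c1) * S))); first exact: ler_sum_nat.
  rewrite sumr_const_nat; set X := _ * S; set m := (_ - _)%N.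
  have -> : (2 + (4 * C ^+ 2 + 2 + c1)) * S = 2 * S + X by rewrite mulrDl.
  rewrite expRD -[_ *+ m]mulr_natl; apply: ler_wpM2r; first exact: expR_ge0.
  apply: (@le_trans _ _ (k%:R ^+ 2)).
    by rewrite -natrX ler_nat leq_subLR -add1n leq_add2r.
  by rewrite natrX_expR // ler_expR ler_wpM2l.
rewrite natrD.
apply: (@le_trans _ _ (expR (2 * c2 * S) + expR ((2 + (4 * C ^+ 2 + 2 + c1)) * S))).
  exact: lerD.
set A := 2 * c2 * S; set B := (2 + _) * S.
have S_ge0 : 0 <= S by apply: le_trans S_ge1.
have A_ge0 : 0 <= A by apply: mulr_ge0 => //; apply: mulr_ge0.
have B_ge0 : 0 <= B by apply: mulr_ge0 => //; clear - c1_ge0 C2_ge0; lra.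
apply: (@le_trans _ _ (expR 1 * expR (A + B))).
  have eA : expR A <= expR (A + B) by rewrite ler_expR lerDl.
  have eB : expR B <= expR (A + B) by rewrite ler_expR lerDr.
  have e2 : 2 <= expR 1 :> R by have := expR_ge1Dx (1 : R); clear; lra.
  apply: le_trans (lerD eA eB) _; rewrite -mulr2n -[leLHS]mulr_natl.
  by apply: ler_wpM2r => //; apply: expR_ge0.
have -> : c_tot * S = S + (A + B) by rewrite /A /B /c_tot; clear; ring.
by rewrite -expRD ler_expR lerD2r.
Qed.

(** * Existence of the class *)

Lemma natural_above (R : realType) (x : R) :
  exists n0 : nat, forall n, (n0 <= n)%N -> x <= n%:R.
Proof.
exists (Num.truncn `|x|).+1 => n nx; apply: le_trans (ler_norm x) _.
have /truncn_itv/andP[_ /ltW x_le] := normr_ge0 x.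
by apply: le_trans x_le _; rewrite ler_nat.
Qed.

Lemma exists_families (R : realType) (delta C s : R) (f : R -> R) :
  growth delta C s f -> exists (n0 k0 : nat) (F : forall n, {set sgraph 'I_n}),
  s <= k0%:R /\ forall n, (n0 <= n)%N ->
    [/\ (#|F n| <= host_size f n ^ 2)%N,
        forall G, G \in F n -> forall k (h : 'I_k -> 'I_n) (H : sgraph 'I_k),
          (k0 <= k)%N -> injective h -> edge_hom H G h ->
          (#|val H| <= if k ^ 2 < n then sparse_bound delta f k
                       else dense_bound delta C s f k)%N &
        forall D : {ffun 'I_(host_size f n) * 'I_(host_size f n) -> bool},
          exists2 G, G \in F n & forall h, ~~ encodes D h G].
Proof.
move=> gf; have [/andP[delta_gt0 delta_lt1] C_ge1 s_ge2 _] := gf.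
have [x1 sparse] := sparse_regime gf; have [x2 few] := few_encodings gf.
have [k0 k0P] := natural_above s.
have [n1 n1P] := natural_above x1; have [n2 n2P] := natural_above x2.
have [n3 n3P] := natural_above (Num.max s 5).
pose n0 := maxn n1 (maxn n2 n3).
suff H n : exists F : {set sgraph 'I_n}, (n0 <= n)%N ->
    [/\ (#|F| <= host_size f n ^ 2)%N,
        forall G, G \in F -> forall k (h : 'I_k -> 'I_n) (H : sgraph 'I_k),
          (k0 <= k)%N -> injective h -> edge_hom H G h ->
          (#|val H| <= if k ^ 2 < n then sparse_bound delta f k
                       else dense_bound delta C s f k)%N &
        forall D : {ffun 'I_(host_size f n) * 'I_(host_size f n) -> bool},
          exists2 G, G \in F & forall h, ~~ encodes D h G].
  exists n0, k0, (fun n => projT1 (cid (H n))); split; first exact: k0P.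
  by move=> n n0n; case: (cid (H n)) => F /= /(_ n0n).
have [n0n|] := boolP (n0 <= n)%N; last by exists finset.set0.
move: (n0n); rewrite !geq_max => /and3P[/n1P x1n /n2P x2n /n3P].
rewrite ge_max => /andP[sn n5].
have k0s := k0P _ (leqnn k0).
have [|||||F FP] := @sparse_unencodable_family n (edge_number delta f n)
  (host_size f n) k0 (fun k => if (k ^ 2 < n)%N then sparse_bound delta f k
                       else dense_bound delta C s f k).
- rewrite truncn_gt0 -[leLHS]expR0 ler_expR; have [_ f_ge1] := growth_ge gf sn.
  by rewrite mulr_ge0 ?ln_ge0 //; lra.
- by rewrite -(ler_nat R).
- by rewrite -(ler_nat R) (le_trans s_ge2).
- exact: few.
- move=> k /andP[k0k kn]; have sk := k0P _ k0k.
  have [k2n|nk2] := ltnP (k ^ 2)%N n; first exact: (sparse _ _ sk k2n x1n _ erefl).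
  by apply: (dense_regime gf sk _ erefl); rewrite kn.
- by exists F.
Qed.

(** A relation on at most u points, such as a universal graph or a decoder acting
    on labels, is carried by a relation on 'I_u. *)
Lemma small_relation_misses (n u : nat) (F : {set sgraph 'I_n}) (V : finType)
    (A : V -> V -> bool) :
  (#|V| <= u)%N ->
  (forall D : {ffun 'I_u * 'I_u -> bool},
     exists2 G, G \in F & forall h, ~~ encodes D h G) ->
  exists2 G, G \in F & forall h : 'I_n -> V,
    ~ (forall x y, x != y -> A (h x) (h y) = adj G x y).
Proof.
move=> Vu unenc; pose emb (v : V) : 'I_u := widen_ord Vu (enum_rank v).
have emb_inj : injective emb.
  by move=> v w /(congr1 val) /= /val_inj; apply: enum_rank_inj.
pose D := [ffun ab : 'I_u * 'I_u =>
  [exists v, exists w, [&& emb v == ab.1, emb w == ab.2 & A v w]]].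
have DE v w : D (emb v, emb w) = A v w.
  rewrite ffunE /=; apply/existsP/idP => [[v' /existsP[w' /and3P[]]]|Avw].
    by move=> /eqP/emb_inj -> /eqP/emb_inj ->.
  by exists v; apply/existsP; exists w; rewrite !eqxx.
have [G GF notD] := unenc D; exists G => // h hA.
pose g := [ffun x => emb (h x)].
have gE x : g x = emb (h x) by rewrite ffunE.
have /negP := notD g; apply; apply/encodesP => x y neq.
by rewrite !gE DE hA.
Qed.

Theorem theorem1p4 (R : realType) (f : R -> R) (hf : decent f) :
  exists X : graph_class,
    [/\ monotone_class X,
        speed_exp_bigO X (fun n : nat => n%:R * f n%:R),
        ~ admits_universal_graph_of_size_at_most X
            (fun n : nat => 2 `^ (f n%:R * log2 n%:R)) &
        ~ admits_labeling_scheme_of_size_at_most X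
            (fun n : nat => f n%:R * log2 n%:R)].
Proof.
have [delta [C [s [delta01 C_ge1 s_ge2 df]]]] := hf.
have gf : growth delta C s f by split.
have [n0 [k0 [F [k0s FP]]]] := exists_families gf.
have [c [x0 [c_ge0 speed_le]]] := speed_bound_expR gf.
pose X := family_class F n0.
have ln2_gt0 : 0 < ln 2 :> R by rewrite ln_gt0 // ltr1n.
have pow2 (x : R) : 2 `^ x = expR (x * ln 2).
  by rewrite /powR gt_eqF.
have sizeE (n : nat) : 2 `^ (f n%:R * log2 n%:R) = expR (f n%:R * ln n%:R).
  by rewrite pow2 /log2 mulrA divfK ?gt_eqF.
have F_in n G : (n0 <= n)%N -> G \in F n -> X _ G.
  move=> n0n GF; exists n; split => //; exists G => //.
  by exists id.
exists X; split.
- exact: family_class_monotone.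
- have speed_gt0 n : 0 < (speed X n)%:R :> R.
    rewrite ltr0n; apply: speed_family_class_gt0 => m n0m.
    have [_ _ unenc] := FP m n0m.
    by have [G GF _] := unenc [ffun=> true]; exists G.
  exists (fun n => log2 (speed X n)%:R).
    by move=> n; rewrite pow2 /log2 divfK ?gt_eqF // lnK ?posrE.
  apply/eqO_exP; exists ((c + 1) / ln 2); first by rewrite divr_gt0 //; lra.
  have [k1 k1P] := natural_above x0.
  near=> k.
  have k_ge : (maxn k1 (maxn k0 1) <= k)%N by near: k; exact: nbhs_infty_ge.
  move: k_ge; rewrite !geq_max => /and3P[/k1P x0k k0k k_gt0].
  have sk : s <= k%:R by apply: le_trans k0s _; rewrite ler_nat.
  have [_ f_ge1] := growth_ge gf sk.
  have le_speed : (speed X k)%:R <= expR (c * (k%:R * f k%:R)).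
    apply: le_trans (speed_le k x0k); rewrite ler_nat.
    apply: speed_family_class => // n n0n; first by have [] := FP n n0n.
    move=> G GF h H h_inj hom; have [_ sparse _] := FP n n0n.
    exact: sparse GF _ h H k0k h_inj hom.
  have kf_ge0 : 0 <= k%:R * f k%:R by rewrite mulr_ge0 //; lra.
  have ln_speed_ge0 : 0 <= ln (speed X k)%:R :> R.
    by rewrite ln_ge0 // ler1n -(ltr0n R).
  rewrite /log2 [X in _ <= _ * X]ger0_norm // ger0_norm; last first.
    by rewrite divr_ge0 // ltW.
  rewrite mulrAC ler_pM2r ?invr_gt0 //.
  rewrite -ler_expR lnK ?posrE //; apply: le_trans le_speed _.
  by rewrite ler_expR ler_wpM2r //; lra.
- move=> [u [V [U [/= [N _ u_le] univ]]]].
  pose n := maxn N n0; have n0n : (n0 <= n)%N by apply: leq_maxr.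
  have [cardV embeds] := univ n; have [_ _ unenc] := FP n n0n.
  have Vu : (#|V n| <= host_size f n)%N.
    rewrite truncn_ge_nat ?expR_ge0 // -sizeE; apply: le_trans cardV _.
    by apply: u_le; rewrite /= leq_maxl.
  have [G GF missed] := small_relation_misses (adj (U n)) Vu unenc.
  have [h _ hE] := embeds _ G (card_ord n) (F_in _ _ n0n GF).
  by apply: (missed h) => x y _; rewrite hE.
- move=> [b [encoder [decoder [/= [N _ b_le] scheme]]]].
  pose n := maxn N n0; have n0n : (n0 <= n)%N by apply: leq_maxr.
  have [_ _ unenc] := FP n n0n.
  have Vu : (#|{: (b n).-tuple bool}| <= host_size f n)%N.
    rewrite truncn_ge_nat ?expR_ge0 // -sizeE card_tuple card_bool natrX.
    rewrite -powR_mulrn // ler_powR ?ler1n //.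
    by apply: b_le; rewrite /= leq_maxl.
  have [G GF missed] := small_relation_misses
    (fun l l' : (b n).-tuple bool => decoder l l') Vu unenc.
  apply: (missed (encoder n G)) => x y neq; apply: scheme => //.
  by rewrite inE; apply/asboolP; apply: F_in.
Unshelve. all: by end_near.
Qed.
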